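(* Let $\Theta\subseteq\mathbb R$ be an open interval containing $0$ and let $(F_\theta)_{\theta\in\Theta}$ be a family of continuous joint cdf's on $\mathbb R^2$ with common marginal cdf's $G$ and $H$ not depending on $\theta$, such that $F_0(x,y)=G(x)H(y)$ for all real $x,y$. Let $\|F_\theta-F_0\|:=\int_{\mathbb R^2}|d(F_\theta-F_0)|$. If $\|F_\theta-F_0\|^2=o(|\theta|)$ as $\theta\to0$ and $$\liminf_{\theta\to0}\Big|\frac1\theta\int_{\mathbb R^2}(F_\theta-F_0)\,dF_0\Big|>0,$$ then $\mathsf{ARE}_{T,S}(0)=1$.
   Context: $\int|d(F_\theta-F_0)|$ is the total variation of the signed measure which is the difference of the probability measures with cdf's $F_\theta$ and $F_0$; integrals against $dF_0$ are with respect to the probability measure with cdf $F_0$. $\mathsf{ARE}_{T,S}(0)$ is the (two-sided Pitman) asymptotic relative efficiency, at the independence value $\theta=0$, of Kendall's correlation statistic $T$ relative to Spearman's correlation statistic $S$. With $(X,Y)$ having cdf $F_\theta$ under $\mathsf P_\theta$ (expectation $\mathsf E_\theta$, variance $\mathsf{Var}_\theta$), it is defined by $$\mathsf{ARE}_{T,S}(0):=\frac{\sigma_S^2(0)}{\sigma_T^2(0)}\lim_{\theta\to0}\frac{(\mu_T(\theta)-\mu_T(0))^2}{(\mu_S(\theta)-\mu_S(0))^2},$$ where $\mu_T(\theta)=4\,\mathsf E_\theta F_\theta(X,Y)-1$, $\mu_S(\theta)=12\,\mathsf E_\theta G(X)H(Y)-3$, $\sigma_T^2(\theta)=16\,\mathsf{Var}_\theta\big(2F_\theta(X,Y)-G(X)-H(Y)\big)$,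 and $$\sigma_S^2(\theta)=144\,\mathsf{Var}_\theta\Big((1-G(X))(1-H(Y))+\int_{\mathbb R}F_\theta(X,y)\,dH(y)+\int_{\mathbb R}F_\theta(x,Y)\,dG(x)\Big).$$ The assertion $\mathsf{ARE}_{T,S}(0)=1$ includes existence of the limit. *)

(* Defs.v *)
From HB Require Import structures.
From mathcomp Require Import all_boot all_order all_algebra.
From mathcomp Require Import all_classical all_reals all_analysis.

Set Implicit Arguments.
Unset Strict Implicit.
Unset Printing Implicit Defensive.

Import Order.TTheory GRing.Theory Num.Theory.
Import numFieldNormedType.Exports.

Local Open Scope classical_set_scope.
Local Open Scope ring_scope.

Definition law1 (R : realType) := probability (measurableTypeR R) R.
Definition law2 (R : realType) :=
  probability (measurableTypeR R * measurableTypeR R)%type R.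

Definition cdf1 (R : realType) (Q : law1 R) (x : R) : R :=
  fine (Q `]-oo, x]%classic).

Definition cdf2 (R : realType) (P : law2 R) (x y : R) : R :=
  fine (P (`]-oo, x]%classic `*` `]-oo, y]%classic)).

Section total_variation.
Context (d : measure_display) (T : measurableType d) (R : realType).

(* The value is the same for every Hahn decomposition. *)
Definition total_variation_norm (nu : {charge set T -> \bar R}) : R :=
  let PN := cid (Hahn_decomposition nu) in
  let N := cid (projT2 PN) in
  fine (charge_variation (projT2 N) setT).

(* Total mass of |P - Q|, without the factor 1/2 of some conventions. *)
Definition total_variation_dist (P Q : {finite_measure set T -> \bar R}) : R :=
  total_variation_norm
    (cadd (charge_of_finite_measure P) (copp (charge_of_finite_measure Q))).
End total_variation.

(* A law P on R^2 is realised canonically, so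
   that z.1 and z.2 play the parts of X and Y.  The laws QG and QH have cdf's
   G and H, so that integrating against QH is integrating against dH. *)
Section correlation_statistics.
Context (R : realType) (QG QH : law1 R).
Let G := cdf1 QG.
Let H := cdf1 QH.

Definition kendall_mean (P : law2 R) : R :=
  4 * fine 'E_P[fun z => cdf2 P z.1 z.2] - 1.

Definition spearman_mean (P : law2 R) : R :=
  12 * fine 'E_P[fun z => G z.1 * H z.2] - 3.

Definition kendall_var (P : law2 R) : R :=
  16 * fine 'V_P[fun z => 2 * cdf2 P z.1 z.2 - G z.1 - H z.2].

Definition spearman_var (P : law2 R) : R :=
  144 * fine 'V_P[fun z => (1 - G z.1) * (1 - H z.2)
                    + \int[QH]_y cdf2 P z.1 y + \int[QG]_x cdf2 P x z.2].
End correlation_statistics.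

Section asymptotic_relative_efficiency.
Context (R : realType) (muT muS varT varS : R -> R).

Definition squared_mean_ratio (t : R) : R :=
  (muT t - muT 0) ^+ 2 / (muS t - muS 0) ^+ 2.

Definition ARE0 : R :=
  varS 0 / varT 0 * lim (squared_mean_ratio t @[t --> 0^']).

(* Division by 0 and lim are total, so ARE0 is meaningful only under these
   conditions. *)
Definition ARE0_exists : Prop :=
  [/\ varT 0 != 0,
      \forall t \near 0^', muS t - muS 0 != 0 &
      cvg (squared_mean_ratio t @[t --> 0^'])].
End asymptotic_relative_efficiency.

(* Main.v *)
(** Write I(t) for the integral of F_t - F_0 against dF_0 and R(t) for its
    integral against d(F_t - F_0).  Integration by parts (Fubini, using that the
    marginals have no atoms) turns the increment of the Spearman mean into
    12 I(t) and that of the Kendall mean into 8 I(t) + 4 R(t), where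
    |R(t)| <= 2 ||F_t - F_0||^2 = o(t) while |I(t)| >= c |t|.  Hence the squared
    ratio of the increments tends to (8/12)^2 = 4/9.  At independence G(X) and
    H(Y) are independent and uniform on [0, 1]; both statistics are then affine
    in (G(X) - 1/2)(H(Y) - 1/2), which gives variances 4/9 and 1. *)

Require Import Defs.
From HB Require Import structures.
From mathcomp Require Import all_boot all_order all_algebra.
From mathcomp Require Import all_classical all_reals all_analysis.
From mathcomp Require Import measurable_realfun ring lra.

Set Implicit Arguments.
Unset Strict Implicit.
Unset Printing Implicit Defensive.

Import Order.TTheory GRing.Theory Num.Theory.
Import numFieldNormedType.Exports.

Local Open Scope classical_set_scope.
Local Open Scope ring_scope.

(** * Bounded measurable functions: closure, integration and Fubini *)

Section bounded_measurable.
Context (R : realType).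

(** Such functions are integrable against every finite measure and form an algebra, so every
    integrability side condition below reduces to closure properties. *)
Definition bmeas d (T : measurableType d) (f : T -> R) :=
  measurable_fun [set: T] f /\ exists M : R, forall x, `|f x| <= M.

Section closure.
Context d (T : measurableType d).
Implicit Types f g : T -> R.

Lemma bmeas_cst (c : R) : bmeas (fun _ : T => c).
Proof. by split; [exact: measurable_cst | exists `|c|]. Qed.

Lemma bmeasD f g : bmeas f -> bmeas g -> bmeas (fun x => f x + g x).
Proof.
move=> [mf [M fM]] [mg [N gN]]; split; first exact: measurable_funD.
by exists (M + N) => x; rewrite (le_trans (ler_normD _ _))// lerD.
Qed.

Lemma bmeasM f g : bmeas f -> bmeas g -> bmeas (fun x => f x * g x).
Proof.
move=> [mf [M fM]] [mg [N gN]]; split; first exact: measurable_funM.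
by exists (M * N) => x; rewrite normrM ler_pM.
Qed.

Lemma bmeasN f : bmeas f -> bmeas (fun x => - f x).
Proof.
move=> [mf [M fM]]; split; first exact: measurable_funN.
by exists M => x; rewrite normrN.
Qed.

Lemma bmeasB f g : bmeas f -> bmeas g -> bmeas (fun x => f x - g x).
Proof. by move=> bf bg; apply: bmeasD => //; exact: bmeasN. Qed.

Lemma bmeas_indic (A : set T) : measurable A -> bmeas (\1_A : T -> R).
Proof.
move=> mA; split; first exact: measurable_indic.
by exists 1 => x; rewrite indicE normr_nat; case: (_ \in _); rewrite ?ler01.
Qed.

Lemma bmeas_comp d' (T' : measurableType d') (h : T' -> T) f :
  measurable_fun [set: T'] h -> bmeas f -> bmeas (fun x => f (h x)).
Proof.
move=> mh [mf [M fM]]; split; first exact: (measurableT_comp mf mh).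
by exists M.
Qed.

Lemma bmeas_integrable_lty (mu : {measure set T -> \bar R}) f :
  (mu [set: T] < +oo)%E -> bmeas f -> mu.-integrable [set: T] (EFin \o f).
Proof.
move=> muoo [mf [M fM]]; apply: measurable_bounded_integrable => //.
exists M; split; first by rewrite num_real.
by move=> N MN x _ /=; rewrite (le_trans (fM x))// ltW.
Qed.

Lemma bmeas_integrable (mu : {finite_measure set T -> \bar R}) f :
  bmeas f -> mu.-integrable [set: T] (EFin \o f).
Proof.
by apply: bmeas_integrable_lty; exact: fin_num_fun_lty (fin_num_measure mu).
Qed.

Lemma bRintegralD (mu : {finite_measure set T -> \bar R}) f g :
  bmeas f -> bmeas g ->
  \int[mu]_x (f x + g x) = \int[mu]_x f x + \int[mu]_x g x.
Proof. by move=> bf bg; rewrite RintegralD//; exact: bmeas_integrable. Qed.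

Lemma bRintegralB (mu : {finite_measure set T -> \bar R}) f g :
  bmeas f -> bmeas g ->
  \int[mu]_x (f x - g x) = \int[mu]_x f x - \int[mu]_x g x.
Proof. by move=> bf bg; rewrite RintegralB//; exact: bmeas_integrable. Qed.

Lemma bRintegralZl (mu : {finite_measure set T -> \bar R}) (c : R) f :
  bmeas f -> \int[mu]_x (c * f x) = c * \int[mu]_x f x.
Proof. by move=> bf; rewrite RintegralZl//; exact: bmeas_integrable. Qed.

Lemma bRintegralZr (mu : {finite_measure set T -> \bar R}) (c : R) f :
  bmeas f -> \int[mu]_x (f x * c) = (\int[mu]_x f x) * c.
Proof. by move=> bf; rewrite RintegralZr//; exact: bmeas_integrable. Qed.

Lemma Rintegral_probability_cst (P : probability T R) (c : R) :
  \int[P]_x c = c.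
Proof.
have P1 : (P : {measure set T -> \bar R}) [set: T] = 1%E := probability_setT P.
by rewrite Rintegral_cst// P1 mulr1.
Qed.

Lemma Rintegral_indic (mu : {measure set T -> \bar R}) (A : set T) :
  measurable A -> \int[mu]_x \1_A x = fine (mu A).
Proof. by move=> mA; rewrite /Rintegral integral_indic// setIT. Qed.

End closure.

Section fubini.
Context d1 d2 (T1 : measurableType d1) (T2 : measurableType d2).
Variables (P : probability T1 R) (Q : probability T2 R).
Variable f : T1 * T2 -> R.
Hypothesis bf : bmeas f.

Lemma bmeas_pairl (x : T1) : bmeas (fun y => f (x, y)).
Proof. exact: (bmeas_comp (measurable_pair1 x)). Qed.

Lemma bmeas_pairr (y : T2) : bmeas (fun x => f (x, y)).
Proof. exact: (bmeas_comp (measurable_pair2 y)). Qed.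

Let inner1E x : (\int[Q]_y f (x, y))%:E = (\int[Q]_y (f (x, y))%:E)%E.
Proof.
rewrite fineK//; apply: integrable_fin_num => //.
exact: (bmeas_integrable Q (bmeas_pairl x)).
Qed.

Let inner2E y : (\int[P]_x f (x, y))%:E = (\int[P]_x (f (x, y))%:E)%E.
Proof.
rewrite fineK//; apply: integrable_fin_num => //.
exact: (bmeas_integrable P (bmeas_pairr y)).
Qed.

Let intf : (P \x Q)%E.-integrable [set: T1 * T2] (EFin \o f).
Proof.
apply: bmeas_integrable_lty bf.
rewrite -setXTT [ltLHS]product_measure1E//.
have fP : P [set: T1] \is a fin_num by exact: fin_num_measure.
have fQ : Q [set: T2] \is a fin_num by exact: fin_num_measure.
by rewrite ltey_eq fin_numM.
Qed.

Lemma Rintegral_prod1 :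
  \int[(P \x Q)%E]_z f z = \int[P]_x \int[Q]_y f (x, y).
Proof.
rewrite /Rintegral; under [in RHS]eq_integral do rewrite inner1E.
by rewrite -(integral12_prod_meas1 intf).
Qed.

Lemma Rintegral_prod2 :
  \int[(P \x Q)%E]_z f z = \int[Q]_y \int[P]_x f (x, y).
Proof.
rewrite /Rintegral; under [in RHS]eq_integral do rewrite inner2E.
by rewrite -(integral21_prod_meas1 intf).
Qed.

Lemma bFubini :
  \int[P]_x \int[Q]_y f (x, y) = \int[Q]_y \int[P]_x f (x, y).
Proof. by rewrite -Rintegral_prod1 Rintegral_prod2. Qed.

(** Fubini gives measurability, and averaging against a probability preserves the bound [M]. Cdfs
    enter the class [bmeas] this way. *)
Lemma bmeas_Rintegral : bmeas (fun x => \int[Q]_y f (x, y)).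
Proof.
split.
  apply/measurable_EFinP; apply: eq_measurable_fun (measurable_fubini_F intf).
  by move=> x _ /=; rewrite inner1E.
have [_ [M fM]] := bf; exists M => x.
apply: le_trans (le_normr_Rintegral _ _) _ => //.
  exact: bmeas_integrable (bmeas_pairl x).
rewrite -[leRHS](Rintegral_probability_cst Q M).
have [mf _] := bmeas_pairl x.
apply: le_Rintegral => //; apply: bmeas_integrable; last exact: bmeas_cst.
split; first exact: measurableT_comp.
by exists M => y; rewrite normr_id.
Qed.

End fubini.
End bounded_measurable.

(** * Laws determined by their cdfs *)

Section laws.
Context (R : realType).
Local Notation RT := (measurableTypeR R).

Let rays : set (set R) := [set A | exists x, A = `]-oo, x]%classic].

Lemma measurable_rays : @measurable _ RT = <<s rays >>.
Proof.
rewrite [LHS]RGenOInfty.measurableE eqEsubset; split.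
  apply: smallest_sub; first exact: smallest_sigma_algebra.
  move=> _ [x ->]; rewrite -setCitvl; apply: sigma_algebraC.
  by apply: sub_sigma_algebra; exists x.
apply: smallest_sub; first exact: smallest_sigma_algebra.
move=> _ [x ->]; rewrite -setCitvr; apply: sigma_algebraC.
by apply: sub_sigma_algebra; exists x.
Qed.

(** A pi-system argument: closed left rays are stable under intersection, generate the Borel sets,
    and those with natural endpoints cover the line. *)
Lemma measure_rays_unique (m1 m2 : {measure set RT -> \bar R}) :
  (m1 setT < +oo)%E ->
  (forall x : R, m1 `]-oo, x]%classic = m2 `]-oo, x]%classic) ->
  forall A, measurable A -> m1 A = m2 A.
Proof.
move=> m1oo m12.
have raysI : setI_closed rays.
  move=> _ _ [x ->] [y ->]; exists (Num.min x y).
  apply/seteqP; split=> z /=; rewrite !in_itv/= le_min; first by case=> -> ->.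
  by move=> /andP.
have rayscover : \bigcup_(n : nat) `]-oo, n%:R : R]%classic = setT.
  apply/seteqP; split=> // x _; exists (Num.bound `|x|) => //=.
  by rewrite in_itv/= ltW// (le_lt_trans (ler_norm x))// archi_boundP.
move=> A mA.
have := @measure_unique _ _ RT rays (fun n => `]-oo, n%:R]%classic)
  measurable_rays raysI _ rayscover m1 m2; apply => //.
- by move=> n; exists n%:R.
- by move=> _ [x ->].
- by move=> k; apply: le_lt_trans m1oo; apply: le_measure; rewrite ?inE.
Qed.

(** One coordinate at a time: with one side of the rectangle fixed, restricting to the corresponding
    strip and projecting gives measures on the line, to which [measure_rays_unique] applies. *)
Lemma measure_quadrants_unique (m1 m2 : {measure set (RT * RT) -> \bar R}) :
  (m1 setT < +oo)%E ->
  (forall x y : R, m1 (`]-oo, x]%classic `*` `]-oo, y]%classic) =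
                   m2 (`]-oo, x]%classic `*` `]-oo, y]%classic)) ->
  forall A B : set RT, measurable A -> measurable B ->
    m1 (A `*` B) = m2 (A `*` B).
Proof.
move=> m1oo m12.
have step1 (B : set RT) (mB : measurable B) :
    (forall x, m1 (`]-oo, x]%classic `*` B) = m2 (`]-oo, x]%classic `*` B)) ->
    forall A : set RT, measurable A -> m1 (A `*` B) = m2 (A `*` B).
  move=> m12B A mA.
  pose D := @setT RT `*` B; have mD : measurable D by exact: measurableX.
  have restrE (m : {measure set (RT * RT) -> \bar R}) (X : set RT) :
      pushforward (mrestr m mD) (@fst RT RT) X = m (X `*` B).
    rewrite /pushforward /mrestr /D; congr (m _).
    by apply/seteqP; split=> -[x y] /=; tauto.
  rewrite -!restrE; apply: measure_rays_unique => //.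
    rewrite [ltLHS]restrE; apply: le_lt_trans m1oo.
    by apply: le_measure; rewrite ?inE//; exact: measurableX.
  by move=> x; rewrite [LHS]restrE [RHS]restrE.
have step2 (A : set RT) (mA : measurable A) :
    (forall y, m1 (A `*` `]-oo, y]%classic) = m2 (A `*` `]-oo, y]%classic)) ->
    forall B : set RT, measurable B -> m1 (A `*` B) = m2 (A `*` B).
  move=> m12A B mB.
  pose D := A `*` @setT RT; have mD : measurable D by exact: measurableX.
  have restrE (m : {measure set (RT * RT) -> \bar R}) (X : set RT) :
      pushforward (mrestr m mD) (@snd RT RT) X = m (A `*` X).
    rewrite /pushforward /mrestr /D; congr (m _).
    by apply/seteqP; split=> -[x y] /=; tauto.
  rewrite -!restrE; apply: measure_rays_unique => //.
    rewrite [ltLHS]restrE; apply: le_lt_trans m1oo.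
    by apply: le_measure; rewrite ?inE//; exact: measurableX.
  by move=> y; rewrite [LHS]restrE [RHS]restrE.
move=> A B mA mB; apply: step2 => // y; apply: step1 => // x; exact: m12.
Qed.

Lemma cdf1E (Q : law1 R) x : (cdf1 Q x)%:E = Q `]-oo, x]%classic.
Proof. by rewrite fineK// fin_num_measure. Qed.

Lemma cdf2E (P : law2 R) x y :
  (cdf2 P x y)%:E = P (`]-oo, x]%classic `*` `]-oo, y]%classic).
Proof. by rewrite fineK// fin_num_measure//; exact: measurableX. Qed.

(** A factorised cdf makes [P] agree with the product measure on quadrants, hence on rectangles,
    hence on all measurable sets. *)
Lemma Rintegral_indep (P : law2 R) (Q1 Q2 : law1 R) :
  (forall x y, cdf2 P x y = cdf1 Q1 x * cdf1 Q2 y) ->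
  forall f, \int[P]_z f z = \int[(Q1 \x Q2)%E]_z f z.
Proof.
move=> PE f; congr fine; apply: eq_measure_integral => A mA _.
apply/esym; apply: product_measure_unique mA => B C mB mC.
have finP : (P setT < +oo)%E by rewrite ltey_eq fin_num_measure.
transitivity ((Q1 \x Q2)%E (B `*` C)); last by rewrite [LHS]product_measure1E.
apply: (measure_quadrants_unique finP) => // x y.
rewrite [RHS]product_measure1E//; apply: etrans (esym (cdf2E P x y)) _.
by rewrite PE EFinM !cdf1E.
Qed.

(** The cdf is the partial integral of the indicator of a closed half-plane. *)
Lemma bmeas_cdf1 (Q : law1 R) : bmeas (cdf1 Q).
Proof.
pose A := [set z : RT * RT | z.2 <= z.1].
have mA : measurable A.
  by rewrite -[A]setTI; apply: measurable_fun_le.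
rewrite (_ : cdf1 Q = fun x => \int[Q]_y (\1_A (x, y))).
  exact: bmeas_Rintegral (bmeas_indic _ mA).
by apply/funext => x; rewrite /cdf1 -Rintegral_indic.
Qed.

Lemma bmeas_cdf2 (P : law2 R) : bmeas (fun z : RT * RT => cdf2 P z.1 z.2).
Proof.
pose A := [set z : (RT * RT) * (RT * RT) | z.2.1 <= z.1.1] `&`
          [set z | z.2.2 <= z.1.2].
have mA : measurable A.
  by apply: measurableI; rewrite -[X in measurable X]setTI;
     apply: measurable_fun_le => //; exact: measurableT_comp.
rewrite (_ : (fun z => _) = fun x => \int[P]_y (\1_A (x, y))).
  exact: bmeas_Rintegral (bmeas_indic _ mA).
by apply/funext => x; rewrite /cdf2 -Rintegral_indic//; exact: measurableX.
Qed.

End laws.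

(** * Moments of the cdf of an atomless law under that law *)

Section atomless.
Context (R : realType) (Q : law1 R).
Local Notation RT := (measurableTypeR R).

Lemma indic_bool T (b : T -> bool) (x : T) : \1_[set z | b z] x = (b x)%:R :> R.
Proof.
rewrite indicE; congr ((nat_of_bool _)%:R).
by apply/idP/idP => [/set_mem|/mem_set].
Qed.

Lemma bmeas_ler d (T : measurableType d) (f g : T -> R) :
  measurable_fun [set: T] f -> measurable_fun [set: T] g ->
  bmeas (fun z => (f z <= g z)%R%:R : R).
Proof.
move=> mf mg; rewrite (_ : (fun z => _) = \1_[set z | f z <= g z]).
  by apply: bmeas_indic; rewrite -[X in measurable X]setTI;
     exact: measurable_fun_le.
by apply/funext => z; rewrite indic_bool.
Qed.

Lemma indic_set1 (x y : R) : \1_[set x] y = (y == x)%:R :> R.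
Proof.
rewrite -(indic_bool (pred1 x)); congr (\1_ _ y).
by apply/seteqP; split=> z /eqP.
Qed.

Lemma bmeas_eqr (x : R) : bmeas (fun y : RT => (y == x)%:R : R).
Proof.
rewrite (_ : (fun y => _) = \1_[set x]); first exact: bmeas_indic.
by apply/funext => y; rewrite indic_set1.
Qed.

Lemma indic_ray (x u : R) :
  \1_(`]-oo, x]%classic) u = (u <= x)%R%:R :> R.
Proof. by rewrite -(indic_bool (fun z => z <= x)) set_itvE. Qed.

Lemma Rintegral_ler (x : R) : \int[Q]_y (y <= x)%R%:R = cdf1 Q x.
Proof.
rewrite /cdf1 -Rintegral_indic//.
by apply: eq_Rintegral => y _; rewrite indic_ray.
Qed.

(** An atom at [x] would make the cdf rise by at least its mass between any [y < x] and [x],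
    contradicting continuity at [x]. *)
Lemma continuous_cdf1_atomless : continuous (cdf1 Q) ->
  forall x, Q [set x] = 0%E.
Proof.
move=> cQ x; have Qx : Q [set x] \is a fin_num by rewrite fin_num_measure.
apply/eqP; rewrite eq_le measure_ge0 andbT -(fineK Qx) lee_fin.
rewrite leNgt; apply/negP => q0.
have jump y : y < x -> cdf1 Q y + fine (Q [set x]) <= cdf1 Q x.
  move=> yx; rewrite -lee_fin EFinD !cdf1E fineK// -measureU//.
    apply: le_measure; rewrite ?inE//; first exact: measurableU.
    move=> z /= []; rewrite !in_itv/=; last by move->.
    by move/le_trans; apply; exact: ltW.
  apply/seteqP; split=> // z [] /=.
  by rewrite in_itv/= => + zx; rewrite zx leNgt yx.
have := cQ x; move/cvgrPdist_lt/(_ _ q0) => [e /= e0 eQ].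
have yx : x - e / 2 < x by rewrite ltrBlDr ltrDl divr_gt0.
have /eQ : `|x - (x - e / 2)| < e.
  by rewrite subKr gtr0_norm ?divr_gt0// ltr_pdivrMr// ltr_pMr// ltr1n.
have := jump _ yx; rewrite ltNge => Qj /negP; apply.
by rewrite (le_trans _ (ler_norm _))// lerBrDl.
Qed.

Hypothesis atomlessQ : forall x, Q [set x] = 0%E.

Lemma Rintegral_atom (f : RT -> R) (x : R) : \int[Q]_y (f y * (y == x)%:R) = 0.
Proof.
transitivity (\int[Q]_y (f x * (y == x)%:R)).
  apply: eq_Rintegral => y _; have [->//|_] := eqVneq y x.
  by rewrite !mulr0.
rewrite bRintegralZl; last exact: bmeas_eqr.
rewrite (_ : \int[Q]_y _ = \int[Q]_y (\1_[set x] y)).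
  by rewrite Rintegral_indic// [X in fine X](atomlessQ x) mulr0.
by apply: eq_Rintegral => y _; rewrite indic_set1.
Qed.

Let bmeas_ge (x : R) : bmeas (fun y : RT => (y <= x)%R%:R : R).
Proof. exact: bmeas_ler. Qed.

Let bmeas_le (x : R) : bmeas (fun y : RT => (x <= y)%R%:R : R).
Proof. exact: bmeas_ler. Qed.

(** The two closed half-lines at [x] cover the line and overlap only in the null set [[set x]]. *)
Lemma Rintegral_ger (f : RT -> R) (x : R) : bmeas f ->
  \int[Q]_y (f y * (x <= y)%R%:R) =
  \int[Q]_y f y - \int[Q]_y (f y * (y <= x)%R%:R).
Proof.
move=> bf; apply/eqP; rewrite eq_sym subr_eq; apply/eqP.
rewrite -bRintegralD; [|exact: bmeasM|exact: bmeasM].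
rewrite -[LHS]addr0 -(Rintegral_atom f x) -bRintegralD//; last first.
  by apply: bmeasM => //; exact: bmeas_eqr.
apply: eq_Rintegral => y _.
by case: ltgtP => _ /=; rewrite ?mulr0 ?mulr1 ?addr0 ?add0r.
Qed.

(* The pairs [y <= x] and [x <= y] carry the same mass and overlap in a null
   set. *)
Lemma Rintegral_half_square (w : RT -> R) : bmeas w ->
  \int[Q]_x (w x * \int[Q]_y (w y * (y <= x)%R%:R)) = (\int[Q]_x w x) ^+ 2 / 2.
Proof.
move=> bw; have bwle x : bmeas (fun y => w y * (y <= x)%R%:R) by exact: bmeasM.
have bwge x : bmeas (fun y => w y * (x <= y)%R%:R) by exact: bmeasM.
pose K (z : RT * RT) := w z.1 * (w z.2 * (z.2 <= z.1)%R%:R).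
have bK : bmeas K.
  apply: bmeasM; first exact: (bmeas_comp measurable_fst bw).
  apply: bmeasM; first exact: (bmeas_comp measurable_snd bw).
  exact: bmeas_ler.
set S := LHS.
have SE1 : S = \int[Q]_x \int[Q]_y K (x, y).
  by apply: eq_Rintegral => x _; rewrite /K/= bRintegralZl.
have SE2 : S = \int[Q]_x (w x * \int[Q]_y (w y * (x <= y)%R%:R)).
  rewrite SE1 bFubini//; apply: eq_Rintegral => x _.
  by rewrite /K/= -bRintegralZl//; apply: eq_Rintegral => y _; rewrite mulrCA.
(* By [SE2] the value is the same with the order reversed, and the reversed half is the full square
   minus the original half. *)
have SE3 : S = (\int[Q]_x w x) ^+ 2 - S.
  rewrite [LHS]SE2 expr2 -bRintegralZr// -bRintegralB.
  - by apply: eq_Rintegral => x _; rewrite Rintegral_ger// mulrBr.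
  - by apply: bmeasM => //; exact: bmeas_cst.
  - rewrite (_ : (fun x => _) = (fun x => \int[Q]_y K (x, y))).
      exact: bmeas_Rintegral.
    by apply/funext => x; rewrite /K/= bRintegralZl.
by lra.
Qed.

Lemma Rintegral_cdf1 : \int[Q]_x cdf1 Q x = 1 / 2.
Proof.
have := Rintegral_half_square (bmeas_cst _ 1).
rewrite Rintegral_probability_cst expr1n => <-.
apply: eq_Rintegral => x _; rewrite mul1r -Rintegral_ler.
by apply: eq_Rintegral => y _; rewrite mul1r.
Qed.

(** This is [Rintegral_half_square] with [w] the indicator of the ray up to [u]: once [y <= x] and
    [x <= u], the factor for [y <= u] is 1. *)
Lemma Rintegral_cdf1_below (u : R) :
  \int[Q]_x (cdf1 Q x * (x <= u)%R%:R) = cdf1 Q u ^+ 2 / 2.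
Proof.
rewrite -Rintegral_ler -Rintegral_half_square//.
apply: eq_Rintegral => x _; rewrite mulrC.
case: leP => xu; last by rewrite !mul0r.
rewrite !mul1r -Rintegral_ler; apply: eq_Rintegral => y _.
case: (leP y x) => yx; last by rewrite mulr0.
by rewrite (le_trans yx xu) mul1r.
Qed.

(** Writing one factor as the mass of the points [u <= x] and exchanging the integrals returns the
    second moment itself, through [m = 1 / 2 - m / 2]. *)
Lemma Rintegral_cdf1_sqr : \int[Q]_x (cdf1 Q x ^+ 2) = 1 / 3.
Proof.
have bG := bmeas_cdf1 Q; set m := LHS.
have mE : m = 1 / 2 - m / 2.
  transitivity (\int[Q]_x \int[Q]_u (cdf1 Q x * (u <= x)%R%:R)).
    apply: eq_Rintegral => x _.
    by rewrite bRintegralZl// Rintegral_ler expr2.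
  rewrite (@bFubini R _ _ RT RT Q Q
            (fun z : RT * RT => cdf1 Q z.1 * (z.2 <= z.1)%R%:R))/=; last first.
    apply: bmeasM; last exact: bmeas_ler.
    exact: (bmeas_comp measurable_fst bG).
  transitivity (\int[Q]_u (1 / 2 - cdf1 Q u ^+ 2 / 2)).
    apply: eq_Rintegral => u _.
    by rewrite Rintegral_ger// Rintegral_cdf1 Rintegral_cdf1_below.
  have bG2 : bmeas (fun u : RT => cdf1 Q u ^+ 2) by exact: bmeasM.
  rewrite bRintegralB; [|exact: bmeas_cst|].
    by rewrite Rintegral_probability_cst bRintegralZr.
  by apply: bmeasM => //; exact: bmeas_cst.
by lra.
Qed.

End atomless.

(** * Total variation as a bound on differences of integrals *)

Section total_variation.
Context d (T : measurableType d) (R : realType) (P Q : probability T R).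
Let tv := total_variation_dist P Q.

Let fin_sub_swap (a b p n : \bar R) :
  a \is a fin_num -> b \is a fin_num -> p \is a fin_num -> n \is a fin_num ->
  (a - b = p - n -> a + n = b + p)%E.
Proof.
move: a b p n => [a| |] [b| |] [p| |] [n| |] //= _ _ _ _.
by rewrite -!EFinB -!EFinD => -[abpn]; congr EFin; lra.
Qed.

(* Jordan: [P + nu^- = Q + nu^+] for [nu = P - Q], and [nu^+] has mass at most
   [tv]. *)
Let jordan : exists m1 m2 : {finite_measure set T -> \bar R},
  (forall A, measurable A -> (P A + m1 A = Q A + m2 A)%E) /\
  fine (m2 setT) <= tv.
Proof.
pose nu := cadd (charge_of_finite_measure P)
  (copp (charge_of_finite_measure Q)).
have tvE : tv = total_variation_norm nu by [].
rewrite tvE /total_variation_norm.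
case: (cid _) => X /= HX; case: (cid _) => Y /= XY.
exists (jordan_neg XY), (jordan_pos XY); split.
  move=> A mA; have := jordan_decomp XY mA.
  rewrite /nu /cadd/= /copp/= cscaleN1.
  by apply: fin_sub_swap; exact: fin_num_measure.
by rewrite /charge_variation/= fineD ?fin_num_measure// lerDl fine_ge0.
Qed.

(** Integrate [f] against both sides of the Jordan identity, drop the nonnegative integral against
    [m1], and bound the one against [m2] by [c] times its mass. *)
Lemma Rintegral_le_total_variation (f : T -> R) (c : R) :
  bmeas f -> (forall x, 0 <= f x <= c) ->
  \int[P]_x f x <= \int[Q]_x f x + c * tv.
Proof.
move=> bf fc; have [m1 [m2 [PQ m2tv]]] := jordan.
have addE (m m' : {finite_measure set T -> \bar R}) :
    \int[measure_add m m']_x f x = \int[m]_x f x + \int[m']_x f x.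
  rewrite /Rintegral integral_measure_add//; [|exact: bmeas_integrable..].
  by rewrite fineD//; apply: integrable_fin_num => //; exact: bmeas_integrable.
have : \int[P]_x f x + \int[m1]_x f x = \int[Q]_x f x + \int[m2]_x f x.
  apply: etrans (esym (addE P m1)) _; apply: etrans (addE Q m2).
  congr fine; apply: eq_measure_integral => A mA _.
  by rewrite [LHS]measure_addE [RHS]measure_addE; exact: PQ.
have m1f : 0 <= \int[m1]_x f x.
  by apply: Rintegral_ge0 => x _; have /andP[] := fc x.
have m2f : \int[m2]_x f x <= c * fine (m2 setT).
  rewrite -Rintegral_cst//; apply: le_Rintegral => //.
  - exact: bmeas_integrable.
  - by apply: bmeas_integrable; exact: bmeas_cst.
  - by move=> x _; have /andP[] := fc x.
have c0 : 0 <= c by have /andP[/le_trans] := fc point; apply.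
have := ler_wpM2l c0 m2tv.
by lra.
Qed.

Lemma Rintegral_dist_total_variation (f : T -> R) (c : R) :
  bmeas f -> (forall x, 0 <= f x <= c) ->
  `|\int[P]_x f x - \int[Q]_x f x| <= c * tv.
Proof.
move=> bf fc; rewrite ler_distl; apply/andP; split; last first.
  exact: Rintegral_le_total_variation.
have bc : bmeas (fun _ : T => c) by exact: bmeas_cst.
(* The lower bound is the upper bound for [c - f], which has the same range. *)
have : \int[P]_x (c - f x) <= \int[Q]_x (c - f x) + c * tv.
  apply: Rintegral_le_total_variation; first exact: bmeasB.
  by move=> x; have := fc x; lra.
rewrite !bRintegralB// !Rintegral_probability_cst.
by lra.
Qed.

Lemma measure_dist_total_variation (A : set T) : measurable A ->
  `|fine (P A) - fine (Q A)| <= tv.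
Proof.
move=> mA; rewrite -!(Rintegral_indic _ mA) -[tv]mul1r.
apply: Rintegral_dist_total_variation; first exact: bmeas_indic.
by move=> x; rewrite indicE; case: (_ \in _); rewrite ?ler01 ?lexx.
Qed.

End total_variation.

(** * The Spearman integral, and the variances at independence *)

Section statistics.
Context (R : realType) (QG QH : law1 R).
Local Notation RT := (measurableTypeR R).
Let G := cdf1 QG.
Let H := cdf1 QH.

Hypothesis atomlessG : forall x, QG [set x] = 0%E.
Hypothesis atomlessH : forall y, QH [set y] = 0%E.

Let bG : bmeas (G : RT -> R). Proof. exact: bmeas_cdf1. Qed.
Let bH : bmeas (H : RT -> R). Proof. exact: bmeas_cdf1. Qed.

Let bmeas_fst (g : RT -> R) : bmeas g -> bmeas (fun z : RT * RT => g z.1).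
Proof. exact: (bmeas_comp measurable_fst). Qed.

Let bmeas_snd (g : RT -> R) : bmeas g -> bmeas (fun z : RT * RT => g z.2).
Proof. exact: (bmeas_comp measurable_snd). Qed.

Section marginals.
Variable P : law2 R.
Hypothesis P_marg1 : forall x, fine (P (`]-oo, x]%classic `*` setT)) = G x.
Hypothesis P_marg2 : forall y, fine (P (setT `*` `]-oo, y]%classic)) = H y.

Let Rintegral_rect (A B : set RT) : measurable A -> measurable B ->
  \int[P]_z (\1_A z.1 * \1_B z.2) = fine (P (A `*` B)).
Proof.
move=> mA mB; rewrite -Rintegral_indic; last exact: measurableX.
by apply: eq_Rintegral => -[x y] _; rewrite !indicE in_setX -natrM mulnb.
Qed.

(** Inclusion-exclusion for the event that both coordinates exceed [x] and [y]. *)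
Lemma Rintegral_survival (x y : R) :
  \int[P]_z ((1 - (z.1 <= x)%R%:R) * (1 - (z.2 <= y)%R%:R)) =
  1 - G x - H y + cdf2 P x y.
Proof.
have b1 : bmeas (fun z : RT * RT => \1_(`]-oo, x]%classic) z.1 : R).
  by apply: bmeas_fst; exact: bmeas_indic.
have b2 : bmeas (fun z : RT * RT => \1_(`]-oo, y]%classic) z.2 : R).
  by apply: bmeas_snd; exact: bmeas_indic.
(* The trivial factors on [setT] put all three terms in rectangle form, so that [Rintegral_rect]
   yields exactly the marginals in the hypotheses. *)
pose T1 := (fun z : RT * RT =>
  \1_(`]-oo, x]%classic) z.1 * \1_(@setT RT) z.2 : R).
pose T2 := (fun z : RT * RT =>
  \1_(@setT RT) z.1 * \1_(`]-oo, y]%classic) z.2 : R).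
pose T12 := (fun z : RT * RT =>
  \1_(`]-oo, x]%classic) z.1 * \1_(`]-oo, y]%classic) z.2 : R).
have bT : bmeas (fun z : RT * RT => \1_(@setT (RT * RT)%type) z : R).
  exact: bmeas_indic.
have bT1 : bmeas T1.
  by apply: bmeasM => //; apply: bmeas_snd; exact: bmeas_indic.
have bT2 : bmeas T2.
  by apply: bmeasM => //; apply: bmeas_fst; exact: bmeas_indic.
have bT12 : bmeas T12 by exact: bmeasM.
have b0 : bmeas (fun _ : RT * RT => 1 : R) by exact: bmeas_cst.
transitivity (\int[P]_z (1 - T1 z - T2 z + T12 z)).
  apply: eq_Rintegral => z _; rewrite /T1 /T2 /T12 !indic_ray !indicT/=.
  by ring.
rewrite bRintegralD//; last by apply: bmeasB => //; exact: bmeasB.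
rewrite bRintegralB//; last exact: bmeasB.
rewrite bRintegralB// Rintegral_probability_cst /T1 /T2 /T12.
by rewrite !Rintegral_rect// P_marg1 P_marg2.
Qed.

(** The integrand is the indicator of [x < u]; without atoms, strict and weak inequality carry the
    same mass. *)
Let cdf1_survival (Q : law1 R) (u : R) : (forall x, Q [set x] = 0%E) ->
  cdf1 Q u = \int[Q]_x (1 - (u <= x)%R%:R).
Proof.
move=> Q0; have b1 : bmeas (fun _ : RT => 1 : R) by exact: bmeas_cst.
rewrite bRintegralB//; last exact: bmeas_ler.
have := Rintegral_ger Q0 u b1; rewrite Rintegral_probability_cst.
under eq_Rintegral do rewrite mul1r.
under [in RHS]eq_Rintegral do rewrite mul1r.
by rewrite Rintegral_ler => ->; rewrite opprB addrC subrK.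
Qed.

(* [G z.1 * H z.2] is the [QG x QH]-mass of the pairs below [z], so the order of
   integration can be exchanged. *)
Lemma Rintegral_cdf1M :
  \int[P]_z (G z.1 * H z.2) =
  \int[QG]_x \int[QH]_y (1 - G x - H y + cdf2 P x y).
Proof.
have b1 d (T : measurableType d) : bmeas (fun _ : T => 1 : R).
  exact: bmeas_cst.
(* First exchange: only [G z.1] is expanded as an integral over [x]. *)
pose f (w : (RT * RT) * RT) : R := (1 - (w.1.1 <= w.2)%R%:R) * H w.1.2.
have bf : bmeas f.
  apply: bmeasM.
    apply: bmeasB => //; apply: bmeas_ler => //.
    exact: (measurableT_comp measurable_fst measurable_fst).
  apply: (bmeas_comp _ bH).
  exact: (measurableT_comp measurable_snd measurable_fst).
transitivity (\int[P]_z \int[QG]_x f (z, x)).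
  apply: eq_Rintegral => z _; rewrite /f/= bRintegralZr -?cdf1_survival//.
  by apply: bmeasB => //; exact: bmeas_ler.
rewrite bFubini//; apply: eq_Rintegral => x _.
(* Second exchange, at fixed [x]: [H z.2] is expanded over [y], leaving the joint survival
   probability under [P]. *)
pose g (w : (RT * RT) * RT) : R :=
  (1 - (w.1.1 <= x)%R%:R) * (1 - (w.1.2 <= w.2)%R%:R).
have bg : bmeas g.
  apply: bmeasM; apply: bmeasB => //; apply: bmeas_ler => //.
    exact: (measurableT_comp measurable_fst measurable_fst).
  exact: (measurableT_comp measurable_snd measurable_fst).
transitivity (\int[P]_z \int[QH]_y g (z, y)).
  apply: eq_Rintegral => z _; rewrite /g/= bRintegralZl -?cdf1_survival//.
  by apply: bmeasB => //; exact: bmeas_ler.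
by rewrite bFubini//; apply: eq_Rintegral => y _; rewrite Rintegral_survival.
Qed.

End marginals.

Section independence.
Variable P : law2 R.
Hypothesis P_indep : forall x y, cdf2 P x y = G x * H y.

Lemma Rintegral_indepM (g h : RT -> R) : bmeas g -> bmeas h ->
  \int[P]_z (g z.1 * h z.2) = \int[QG]_x g x * \int[QH]_y h y.
Proof.
move=> bg bh; rewrite (Rintegral_indep P_indep) Rintegral_prod1/=.
  by rewrite -bRintegralZr//; apply: eq_Rintegral => x _; rewrite bRintegralZl.
by apply: bmeasM; [exact: bmeas_fst|exact: bmeas_snd].
Qed.

Let variance_Rintegral (X : RT * RT -> R) :
  fine 'V_P[X] = \int[P]_z ((X z - \int[P]_w X w) * (X z - \int[P]_w X w)).
Proof. by rewrite /variance covariance.unlock !expectation.unlock. Qed.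

(* [G] and [H] are uniform on [0, 1] under the independent law, hence have mean
   1/2 and variance 1/12. *)
Lemma variance_centered_product (X : RT * RT -> R) (a b : R) :
  (forall z, X z = a * ((G z.1 - 1 / 2) * (H z.2 - 1 / 2)) + b) ->
  fine 'V_P[X] = a ^+ 2 / 144.
Proof.
move=> XE; rewrite variance_Rintegral.
have bc d (T : measurableType d) (c : R) : bmeas (fun _ : T => c).
  exact: bmeas_cst.
pose g x := G x - 1 / 2; pose h y := H y - 1 / 2.
have bg : bmeas (g : RT -> R) by exact: bmeasB.
have bh : bmeas (h : RT -> R) by exact: bmeasB.
have bgh : bmeas (fun z : RT * RT => g z.1 * h z.2).
  by apply: bmeasM; [exact: bmeas_fst|exact: bmeas_snd].
have meanX : \int[P]_w X w = b.
  under eq_Rintegral do rewrite XE.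
  rewrite bRintegralD ?bRintegralZl//; last exact: bmeasM.
  rewrite (Rintegral_indepM bg bh) Rintegral_probability_cst.
  by rewrite /g bRintegralB// Rintegral_probability_cst Rintegral_cdf1//;
    rewrite subrr mul0r mulr0 add0r.
rewrite meanX.
have var_cdf1 (Q : law1 R) : (forall x, Q [set x] = 0%E) ->
    \int[Q]_x ((cdf1 Q x - 1 / 2) * (cdf1 Q x - 1 / 2)) = 1 / 12.
  move=> Q0; have bQ := bmeas_cdf1 Q.
  have bQ2 : bmeas (fun x : RT => cdf1 Q x ^+ 2) by exact: bmeasM.
  transitivity (\int[Q]_x (cdf1 Q x ^+ 2 - cdf1 Q x + 1 / 4)).
    by apply: eq_Rintegral => x _; field.
  rewrite bRintegralD//; last exact: bmeasB.
  rewrite bRintegralB// Rintegral_probability_cst.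
  by rewrite Rintegral_cdf1// Rintegral_cdf1_sqr//; field.
transitivity (\int[P]_z (a ^+ 2 * ((g z.1 * g z.1) * (h z.2 * h z.2)))).
  by apply: eq_Rintegral => z _; rewrite XE /g /h; ring.
have bgg : bmeas (fun x : RT => g x * g x) by exact: bmeasM.
have bhh : bmeas (fun x : RT => h x * h x) by exact: bmeasM.
rewrite bRintegralZl; last first.
  by apply: bmeasM; [exact: (bmeas_fst bgg)|exact: (bmeas_snd bhh)].
rewrite (Rintegral_indepM bgg bhh) /g /h !var_cdf1//.
by field.
Qed.

Lemma kendall_var_indep : kendall_var QG QH P = 4 / 9.
Proof.
(* Here [2GH - G - H = 2(G - 1/2)(H - 1/2) - 1/2], so the value is [16 * 4 / 144]. *)
rewrite /kendall_var (@variance_centered_product _ 2 (- (1 / 2))).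
  by field.
by move=> z; rewrite P_indep -/G -/H; field.
Qed.

Lemma spearman_var_indep : spearman_var QG QH P = 1.
Proof.
(* The inner integrals are [G/2] and [H/2], and [(1 - G)(1 - H) + G/2 + H/2 = (G - 1/2)(H - 1/2) +
   3/4]. *)
rewrite /spearman_var (@variance_centered_product _ 1 (3 / 4)); first by field.
move=> z; rewrite -/G -/H.
rewrite (_ : \int[QH]_y _ = G z.1 / 2); last first.
  under eq_Rintegral do rewrite P_indep.
  by rewrite bRintegralZl// Rintegral_cdf1// div1r.
rewrite (_ : \int[QG]_x _ = H z.2 / 2); last first.
  under eq_Rintegral do rewrite P_indep.
  by rewrite bRintegralZr// Rintegral_cdf1//; ring.
by field.
Qed.

End independence.
End statistics.

(** The lower limit is a supremum of infima over punctured balls, so some such infimum [m] is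
    already positive. *)
Lemma lime_inf_gt0 (R : realType) (f : R -> R) (a : R) :
  (0 < lime_inf (fun t => (f t)%:E) a)%E ->
  exists2 c : R, 0 < c & \forall t \near a^', c <= f t.
Proof.
rewrite lime_infE => /ereal_sup_gt[m /= [e]].
rewrite in_itv/= andbT => e0 mE m0.
have fge : \forall t \near a^', (m <= (f t)%:E)%E.
  near=> t; rewrite -mE leeNl; apply: ereal_sup_ubound => /=.
  by exists t => //; near: t; exact: dnbhs_ball.
case: m m0 fge {mE} => [c| |//] m0 fge; last first.
  (* If [m] is [+oo], then [m <= (f t)%:E] is absurd for a real value and any constant serves. *)
  exists 1 => //; apply: filterS fge => t.
  by rewrite leye_eq.
by exists c => //; apply: filterS fge => t.
Unshelve. all: by end_near. Qed.

(** * Increments of the two means *)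

Section drift.
Context (R : realType) (P P0 : law2 R) (QG QH : law1 R).
Let G := cdf1 QG.
Let H := cdf1 QH.
Hypothesis atomlessG : forall x, QG [set x] = 0%E.
Hypothesis atomlessH : forall y, QH [set y] = 0%E.
Hypothesis P_marg1 : forall x, fine (P (`]-oo, x]%classic `*` setT)) = G x.
Hypothesis P_marg2 : forall y, fine (P (setT `*` `]-oo, y]%classic)) = H y.
Hypothesis P0_marg1 : forall x, fine (P0 (`]-oo, x]%classic `*` setT)) = G x.
Hypothesis P0_marg2 : forall y, fine (P0 (setT `*` `]-oo, y]%classic)) = H y.
Hypothesis P0_indep : forall x y, cdf2 P0 x y = G x * H y.

Let drift := \int[P0]_z (cdf2 P z.1 z.2 - cdf2 P0 z.1 z.2).
Let tv := total_variation_dist P P0.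

Let bF : bmeas (fun z : R * R => cdf2 P z.1 z.2).
Proof. exact: bmeas_cdf2. Qed.

Let bF0 : bmeas (fun z : R * R => cdf2 P0 z.1 z.2).
Proof. exact: bmeas_cdf2. Qed.

(** In [Rintegral_cdf1M] for [P] and [P0] the marginal terms coincide and cancel; what remains is
    integrated against the product of [QG] and [QH], which is [P0]. *)
Let Rintegral_cdf1M_sub :
  \int[P]_z (G z.1 * H z.2) - \int[P0]_z (G z.1 * H z.2) = drift.
Proof.
have bS (P' : law2 R) : bmeas (fun z : measurableTypeR R * measurableTypeR R =>
    1 - G z.1 - H z.2 + cdf2 P' z.1 z.2).
  apply: bmeasD; last exact: bmeas_cdf2.
  apply: bmeasB; last exact: (bmeas_comp measurable_snd (bmeas_cdf1 QH)).
  apply: bmeasB; first exact: bmeas_cst.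
  exact: (bmeas_comp measurable_fst (bmeas_cdf1 QG)).
rewrite !(@Rintegral_cdf1M R QG QH)//.
have prodE (P' : law2 R) := Rintegral_prod1 QG QH (bS P').
rewrite -(prodE P) -(prodE P0) -!(Rintegral_indep P0_indep) -bRintegralB//.
by apply: eq_Rintegral => z _; ring.
Qed.

Lemma spearman_mean_sub :
  spearman_mean QG QH P - spearman_mean QG QH P0 = 12 * drift.
Proof.
rewrite /spearman_mean !expectation.unlock -Rintegral_cdf1M_sub /Rintegral.
by ring.
Qed.

(** With [D] the difference of the cdfs, the increment of the self-integral of the cdf is twice the
    drift plus the integral of [D] against [P - P0]. Total variation enters that remainder twice: as
    a bound on [D] and as the size of [P - P0]. *)
Lemma kendall_mean_sub :
  `|kendall_mean P - kendall_mean P0 - 8 * drift| <= 8 * tv ^+ 2.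
Proof.
pose D (z : R * R) := cdf2 P z.1 z.2 - cdf2 P0 z.1 z.2.
have bD : bmeas D by exact: bmeasB.
have Dtv z : `|D z| <= tv.
  by apply: measure_dist_total_variation; exact: measurableX.
(* Shifting by [tv] moves the range of [D] into the interval from 0 to [2 * tv]; the shift cancels
   between two probabilities. *)
have bDtv : bmeas (fun z => D z + tv) by apply: bmeasD => //; exact: bmeas_cst.
have Ddist : `|\int[P]_z D z - \int[P0]_z D z| <= 2 * tv * tv.
  have Dbnd z : 0 <= D z + tv <= 2 * tv.
    by move: (Dtv z); rewrite ler_norml; lra.
  have := Rintegral_dist_total_variation P P0 bDtv Dbnd.
  have DtvE (P' : law2 R) : \int[P']_z (D z + tv) = \int[P']_z D z + tv.
    by rewrite (bRintegralD P' bD (bmeas_cst _ tv)) Rintegral_probability_cst.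
  by rewrite !DtvE opprD addrACA subrr addr0.
have DPE : \int[P]_z D z =
    \int[P]_z cdf2 P z.1 z.2 - \int[P]_z cdf2 P0 z.1 z.2.
  exact: bRintegralB.
(* Since [cdf2 P0] is the product of [G] and [H], this is the Spearman increment again. *)
have F0E : \int[P]_z cdf2 P0 z.1 z.2 - \int[P0]_z cdf2 P0 z.1 z.2 = drift.
  rewrite -Rintegral_cdf1M_sub.
  by congr (_ - _); apply: eq_Rintegral => z _; rewrite P0_indep.
have muE : kendall_mean P - kendall_mean P0 - 8 * drift =
    4 * (\int[P]_z D z - \int[P0]_z D z).
  rewrite /kendall_mean !expectation.unlock DPE -[\int[P0]_z D z]/drift.
  by move: F0E; rewrite /Rintegral; lra.
rewrite muE normrM ger0_norm//; have := ler_wpM2l (ler0n R 4) Ddist.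
by move/le_trans; apply; rewrite le_eqVlt; apply/orP; left; apply/eqP; ring.
Qed.

End drift.

(** * Continuity of the marginals, the limit of the ratio, and the conclusion *)

Lemma continuous_marginal_cdf1 (R : realType) (F : R -> R -> R) (G : R -> R)
    (Q : law1 R) :
  continuous (fun z : R * R => F z.1 z.2) ->
  (forall x y, F x y = G x * cdf1 Q y) -> continuous G.
Proof.
move=> cF FE.
(* A cdf vanishing everywhere would make [Q] agree with the zero measure on rays. At a [y] where it
   does not vanish, [G] is a section of [F] divided by a constant. *)
have [y Qy] : exists y, cdf1 Q y != 0.
  apply: contrapT => /forallNP Q0.
  suff : Q setT = 0%E.
    by rewrite probability_setT => /eqP; rewrite eqe oner_eq0.
  apply: (@measure_rays_unique _ Q mzero) => //.
    by rewrite ltey_eq fin_num_measure.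
  move=> x; have /negP := Q0 x; rewrite negbK => /eqP Qx.
  by apply: etrans (esym (cdf1E Q x)) _; rewrite Qx.
rewrite (_ : G = fun x => F x y * (cdf1 Q y)^-1); last first.
  by apply/funext => x; rewrite FE mulfK.
move=> x; apply: cvgM; last exact: cvg_cst.
apply: (cvg_comp (fun x => (x, y)) (fun z : R * R => F z.1 z.2) _ (cF (x, y))).
exact: (cvg_pair cvg_id (cvg_cst y)).
Qed.

(** The unsquared ratio is [2 / 3 + q t], where [q] is the Kendall remainder over [12 * I t]; the
    remainder is o(t) while [I] is at least linear, so [q] tends to 0. *)
Lemma squared_mean_ratio_cvg (R : realType) (muT muS I tv : R -> R) (c : R) :
  0 < c ->
  (\forall t \near 0^', c <= `|t^-1 * I t|) ->
  (fun t => tv t ^+ 2) =o_ (0^') (fun t : R => `|t|) ->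
  (\forall t \near 0^', muS t - muS 0 = 12 * I t) ->
  (\forall t \near 0^', `|muT t - muT 0 - 8 * I t| <= 8 * tv t ^+ 2) ->
  (\forall t \near 0^', muS t - muS 0 != 0) /\
  squared_mean_ratio muT muS t @[t --> 0^'] --> (4 / 9 : R).
Proof.
move=> c0 Ic tvo muSE muTE.
have I0 : \forall t \near 0^', I t != 0.
  near=> t; have : c <= `|t^-1 * I t| by near: t.
  by apply: contraTneq => ->; rewrite mulr0 normr0 -ltNge.
split.
  near=> t; have -> : muS t - muS 0 = 12 * I t by near: t.
  by rewrite mulf_neq0//; near: t.
pose q t := (muT t - muT 0 - 8 * I t) / (12 * I t).
have q0 : q t @[t --> 0^'] --> (0 : R).
  apply/cvgrPdist_le => e e0.
  (* The tolerance [e * c] absorbs the lower bound on [I]: the remainder is at most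
     [8 * e * c * |t|], hence at most [8 * e * |I t|], within [e * |12 * I t|]. *)
  have ec0 : 0 < e * c by rewrite mulr_gt0.
  move/eqoP: tvo => /(_ _ ec0) tvo.
  near=> t; rewrite sub0r normrN /q normrM normfV normrM.
  rewrite (ger0_norm (ler0n R 12)).
  have t0 : t != 0 by near: t; exact: nbhs_dnbhs_neq.
  have It0 : 0 < `|I t| by rewrite normr_gt0; near: t.
  have It : c * `|t| <= `|I t|.
    have : c <= `|t^-1 * I t| by near: t.
    by rewrite normrM normfV -ler_pdivrMl// ?invr_gt0 ?normr_gt0// invrK mulrC.
  have tvt : tv t ^+ 2 <= e * c * `|t|.
    have : `|tv t ^+ 2| <= e * c * `| `|t| | by near: t.
    by rewrite normr_id ger0_norm// sqr_ge0.
  rewrite ler_pdivrMr ?mulr_gt0//.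
  have mut : `|muT t - muT 0 - 8 * I t| <= 8 * tv t ^+ 2 by near: t.
  apply: (le_trans mut).
  have := ler_wpM2l (ltW e0) It; have := mulr_gt0 e0 It0; lra.
have : (2 / 3 + q t) ^+ 2 @[t --> 0^'] --> ((2 / 3 + 0) ^+ 2 : R).
  by apply: cvgM; apply: cvgD => //; exact: cvg_cst.
rewrite (_ : (2 / 3 + 0) ^+ 2 = 4 / 9 :> R); last by field.
apply: cvg_trans; apply: near_eq_cvg; near=> t.
have -> : squared_mean_ratio muT muS t = (muT t - muT 0) ^+ 2 / (12 * I t) ^+ 2.
  by rewrite /squared_mean_ratio; congr (_ / _ ^+ 2); near: t.
have It0 : I t != 0 by near: t.
by rewrite /q; field.
Unshelve. all: by end_near. Qed.

Theorem corollary4p3 (R : realType) (Theta : set R)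
    (Theta_open : open Theta) (Theta_itv : is_interval Theta)
    (Theta0 : Theta 0)
    (P : R -> law2 R) (QG QH : law1 R)
    (P_cont : forall t, Theta t ->
       continuous (fun z : R * R => cdf2 (P t) z.1 z.2))
    (P_marg1 : forall t x, Theta t ->
       fine (P t (`]-oo, x]%classic `*` setT)) = cdf1 QG x)
    (P_marg2 : forall t y, Theta t ->
       fine (P t (setT `*` `]-oo, y]%classic)) = cdf1 QH y)
    (P_indep : forall x y, cdf2 (P 0) x y = cdf1 QG x * cdf1 QH y)
    (P_tv : (fun t : R => total_variation_dist (P t) (P 0) ^+ 2)
              =o_ (0^') (fun t : R => `|t|))
    (P_liminf : (0 < lime_inf (fun t : R =>
       (`| t^-1 * \int[P 0]_z (cdf2 (P t) z.1 z.2 - cdf2 (P 0) z.1 z.2) |)%:E)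
         0)%E) :
  let muT t := kendall_mean (P t) in
  let muS t := spearman_mean QG QH (P t) in
  let varT t := kendall_var QG QH (P t) in
  let varS t := spearman_var QG QH (P t) in
  ARE0_exists muT muS varT /\ ARE0 muT muS varT varS = 1.
Proof.
move=> muT muS varT varS.
have P00 := P_cont 0 Theta0.
have cG : continuous (cdf1 QG) := continuous_marginal_cdf1 P00 P_indep.
have cH : continuous (cdf1 QH).
  (* The second marginal is handled by swapping the coordinates. *)
  apply: (@continuous_marginal_cdf1 R (fun y x => cdf2 (P 0) x y) _ QG).
    move=> z; apply: (cvg_comp (fun z : R * R => (z.2, z.1))
      (fun z : R * R => cdf2 (P 0) z.1 z.2) _ (P00 (z.2, z.1))).
    exact: (cvg_pair cvg_snd cvg_fst).
  by move=> y x; rewrite P_indep mulrC.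
have atomG := continuous_cdf1_atomless cG.
have atomH := continuous_cdf1_atomless cH.
have varTE : varT 0 = 4 / 9 by exact: kendall_var_indep.
have varSE : varS 0 = 1 by exact: spearman_var_indep.
(* The marginals are prescribed only on [Theta], so the increment formulas are available only near
   0. *)
have nearTheta : \forall t \near 0^', Theta t.
  by apply: nbhs_dnbhs; exact: open_nbhs_nbhs.
have [c c0 Ic] := lime_inf_gt0 P_liminf.
pose I t := \int[P 0]_z (cdf2 (P t) z.1 z.2 - cdf2 (P 0) z.1 z.2).
have [muS0 ratio] : (\forall t \near 0^', muS t - muS 0 != 0) /\
    squared_mean_ratio muT muS t @[t --> 0^'] --> (4 / 9 : R).
  apply: (@squared_mean_ratio_cvg R muT muS I _ c c0 Ic P_tv).
    apply: filterS nearTheta => t Thetat; apply: spearman_mean_sub => //.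
    - by move=> x; exact: P_marg1.
    - by move=> y; exact: P_marg2.
    - by move=> x; exact: P_marg1.
    - by move=> y; exact: P_marg2.
  apply: filterS nearTheta => t Thetat.
  apply: (kendall_mean_sub (QG := QG) (QH := QH)) => //.
  - by move=> x; exact: P_marg1.
  - by move=> y; exact: P_marg2.
  - by move=> x; exact: P_marg1.
  - by move=> y; exact: P_marg2.
split; first split => //.
- by rewrite varTE gt_eqF// divr_gt0.
- by apply/cvg_ex; exists (4 / 9 : R).
by rewrite /ARE0 varTE varSE (cvg_lim _ ratio)//; field.
Qed.
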